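(* Let $\mathbb{D}\in\mathbb{R}^{M\times M}$ satisfy $\mathbb{D}+\mathbb{D}^T=0$, let $r\ge1$ be an integer, $\gamma\in(0,1)$, $\mathbf{Y}^0\in\mathbb{R}^M$, and let $\widetilde{\mathbf{Y}}_r$ be the output of the explicit time discretization described in the context with $\mathbf{R}=0$. Then \[ \max_{0\le t\le T}\|\widetilde{\mathbf{Y}}_r(t)\|_{\ell_2}\leq\|\mathbf{Y}^0\|_{\ell_2} \] under the CFL condition $\lambda:=\tau\|\mathbb{D}\|_{\ell_2}\le\lambda(r,\gamma)$, where $\lambda(r,\gamma)=\sqrt6$ if $r\equiv0\pmod 4$; $\lambda(1,\gamma)=\sqrt{\frac{1-\gamma^2}{2}}$ and $\lambda(r,\gamma)=\sqrt{\frac{2(1-\gamma)}{3-\gamma}}$ if $r\equiv1\pmod4$, $r\ge5$; $\lambda(2,\gamma)=\sqrt{\frac{2(4-\gamma^2)}{3}}$ and $\lambda(r,\gamma)=\sqrt{\frac{6(2-\gamma)}{4-\gamma}}$ if $r\equiv 2\pmod 4$, $r\ge6$; $\lambda(r,\gamma)=\sqrt2$ if $r\equiv3\pmod4$.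
   Context: The ODE system is $\mathbf{Y}'=\mathbb{D}\mathbf{Y}+\mathbf{R}$ on $(0,T)$, $\mathbf{Y}(0)=\mathbf{Y}^0$. Let $0=t_0<t_1<\cdots<t_N=T$, $\tau_n=t_{n+1}-t_n$, $\tau=\max_n\tau_n$; $P^m$ denotes real polynomials of degree $\le m$; $\|\cdot\|_{\ell_2}$ is the Euclidean norm and the induced matrix norm. $I_{r-1}\mathbf{R}$ denotes, on each $(t_n,t_{n+1})$, the $L^2(t_n,t_{n+1})$-orthogonal projection of $\mathbf{R}$ onto $[P^{r-1}]^M$. For $1\le m\le r$ set $\gamma_m^r=0$ if $r\equiv0,3\pmod4$ and $\gamma_m^r=\frac{(m+1)(m-1+\gamma)}{m(m+\gamma)}$ if $r\equiv1,2\pmod4$. Scheme: $\widetilde{\mathbf{Y}}_r$ is a continuous function on $[0,T]$, polynomial of degree $\le\max(2r-1,r+1)$ on each $[t_n,t_{n+1}]$, with $\widetilde{\mathbf{Y}}_r(0)=\mathbf{Y}^0$, computed interval by interval as follows, with $\mathbf{Y}^n=\widetilde{\mathbf{Y}}_r(t_n)$ on $[t_n,t_{n+1}]$: (1) $\mathbf{Y}_0\equiv\mathbf{Y}^n$ and $\widetilde{\mathbf{Y}}_0\in[P^1]^M$ with $\widetilde{\mathbf{Y}}_0'=\frac1\gamma\mathbb{D}\mathbf{Y}^n$, $\widetilde{\mathbf{Y}}_0(t_n)=\mathbf{Y}^n$; (2) for $1\le m\le r$, $\mathbf{Y}_m\in[P^{m+r-1}]^M$ with $\mathbf{Y}_m'=\mathbb{D}\mathbf{Y}_{m-1}+I_{r-1}\mathbf{R}$,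 $\mathbf{Y}_m(t_n)=\mathbf{Y}^n$; (3) for $1\le m\le r$, $\widetilde{\mathbf{Y}}_m\in[P^{\max(m+r-1,m+1)}]^M$ with $\widetilde{\mathbf{Y}}_m'=\mathbb{D}[\gamma_m^r\widetilde{\mathbf{Y}}_{m-1}+(1-\gamma_m^r)\mathbf{Y}_{m-1}]+I_{r-1}\mathbf{R}$, $\widetilde{\mathbf{Y}}_m(t_n)=\mathbf{Y}^n$; and $\widetilde{\mathbf{Y}}_r|_{[t_n,t_{n+1}]}:=\widetilde{\mathbf{Y}}_r$ from step (3) with $m=r$. *)

(* Defs.v *)
From HB Require Import structures.
From mathcomp Require Import all_boot all_order all_algebra.
From mathcomp Require Import boolp classical_sets reals.
Set Implicit Arguments. Unset Strict Implicit. Unset Printing Implicit Defensive.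
Import Order.TTheory GRing.Theory Num.Theory.
Local Open Scope ring_scope.
Local Open Scope classical_set_scope.

Section Defs.
Variable R : realType.

Definition l2norm (M : nat) (v : 'cV[R]_M) : R :=
  Num.sqrt (\sum_(i < M) (v i ord0) ^+ 2).

Definition opnorm (M : nat) (D : 'M[R]_M) : R :=
  sup [set l2norm (D *m x) | x in [set x : 'cV[R]_M | l2norm x <= 1]].

Definition intp (p : {poly R}) : {poly R} :=
  \poly_(i < (size p).+1) (if i is k.+1 then p`_k / k.+1%:R else 0).

Definition gam (r m : nat) (g : R) : R :=
  if (r %% 4 == 0)%N || (r %% 4 == 3)%N then 0
  else ((m.+1)%:R * ((m%:R - 1) + g)) / (m%:R * (m%:R + g)).

Definition cfl (r : nat) (g : R) : R :=
  if (r %% 4 == 0)%N then Num.sqrt 6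
  else if (r == 1)%N then Num.sqrt ((1 - g ^+ 2) / 2)
  else if (r %% 4 == 1)%N then Num.sqrt (2 * (1 - g) / (3 - g))
  else if (r == 2)%N then Num.sqrt (2 * (4 - g ^+ 2) / 3)
  else if (r %% 4 == 2)%N then Num.sqrt (6 * (2 - g) / (4 - g))
  else Num.sqrt 2.

Variables (M : nat) (D : 'M[R]_M) (g : R) (r : nat).

(* Polynomial (in the local variable s = t - t_n) vector-valued functions
   are represented as column vectors of polynomials. *)
Definition Dp : 'M[{poly R}]_M := map_mx polyC D.
Definition cstp (v : 'cV[R]_M) : 'cV[{poly R}]_M := map_mx polyC v.
Definition intv (P : 'cV[{poly R}]_M) : 'cV[{poly R}]_M := map_mx intp P.
Definition evalv (P : 'cV[{poly R}]_M) (s : R) : 'cV[R]_M :=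
  map_mx (fun p => p.[s]) P.

(* Stages (Y_m, Ytilde_m) on one interval, starting from Yn, with R = 0:
   Y_0 = Yn, Ytilde_0' = (1/g) D Yn, Ytilde_0(t_n) = Yn;
   Y_m' = D Y_{m-1}, Y_m(t_n) = Yn;
   Ytilde_m' = D (gam_m Ytilde_{m-1} + (1 - gam_m) Y_{m-1}), Ytilde_m(t_n) = Yn. *)
Fixpoint stages (Yn : 'cV[R]_M) (m : nat) : 'cV[{poly R}]_M * 'cV[{poly R}]_M :=
  match m with
  | 0 => (cstp Yn, cstp Yn + intv (g^-1%:P *: (Dp *m cstp Yn)))
  | m'.+1 =>
      let: (Y, Yt) := stages Yn m' in
      (cstp Yn + intv (Dp *m Y),
       cstp Yn + intv (Dp *m ((gam r m g)%:P *: Yt + (1 - gam r m g)%:P *: Y)))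
  end.

Definition step (Yn : 'cV[R]_M) : 'cV[{poly R}]_M := (stages Yn r).2.

Variables (t : nat -> R) (Y0 : 'cV[R]_M).

(* Nodal values Y^n = Ytilde_r(t_n) (continuity of Ytilde_r). *)
Fixpoint node (n : nat) : 'cV[R]_M :=
  match n with
  | 0 => Y0
  | n'.+1 => evalv (step (node n')) (t n'.+1 - t n')
  end.

(* Ytilde_r(x) for x in [t_n, t_{n+1}]. *)
Definition Ytilde (n : nat) (x : R) : 'cV[R]_M := evalv (step (node n)) (x - t n).

Definition taumax (N : nat) : R := \big[Num.max/0]_(n < N) (t n.+1 - t n).

End Defs.

(* Main.v *)
Require Import Defs.
From HB Require Import structures.
From mathcomp Require Import all_boot all_order all_algebra.
From mathcomp Require Import boolp classical_sets reals.
From mathcomp Require Import ring lra zify.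
Import Order.TTheory GRing.Theory Num.Theory.
Local Open Scope ring_scope.

(* On one step of length s the scheme multiplies the data by p(sD), where
   p(z) = sum_(k <= r) z^k/k! + c z^(r+1), with c = 0 if r = 0, 3 mod 4, and
   c = 1/(r! (r + g)) if r = 1, 2 mod 4 (the product of the gammas telescopes).
   Since B = sD is skew, |p(B)v|^2 = v^T P(B) v with P(z) = p(z) p(-z). The odd
   powers of B do not contribute, and v^T B^(2l) v = (-1)^l q_l with
   q_l = |B^l v|^2, so that q_(l+1) <= |B|^2 q_l. The coefficients of P between
   degrees 1 and r vanish, and the remaining terms of |v|^2 - |p(B)v|^2 form an
   alternating sum with nonnegative first term, whose terms decrease in absolute
   value under the CFL condition. *)

(** * Closed form of the stages in Taylor polynomials *)

Section Stages.
Set Implicit Arguments.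
Unset Strict Implicit.
Variables (R : realType) (M : nat).
Implicit Types (D : 'M[R]_M) (v w : 'cV[R]_M).

Lemma coef_intp (p : {poly R}) i :
  (intp p)`_i = if i is k.+1 then p`_k / k.+1%:R else 0.
Proof.
rewrite coef_poly; case: i => [|k] //.
rewrite ltnS; case: ltnP => // le_pk.
by rewrite nth_default // mul0r.
Qed.

Lemma intvD (P Q : 'cV[{poly R}]_M) : intv (P + Q) = intv P + intv Q.
Proof.
apply/matrixP => i j; rewrite !mxE; apply/polyP => -[|k].
  by rewrite coefD !coef_intp addr0.
by rewrite coefD !coef_intp coefD mulrDl.
Qed.

Definition monov k w : 'cV[{poly R}]_M := map_mx (fun a => a *: 'X^k) w.

Lemma monov0 w : cstp w = monov 0 w.
Proof. by apply/matrixP => i j; rewrite !mxE expr0 alg_polyC. Qed.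

Lemma mul_Dp_monov D k w : Dp D *m monov k w = monov k (D *m w).
Proof.
apply/matrixP => i j; rewrite !mxE scaler_suml; apply: eq_bigr => l _.
by rewrite !mxE mul_polyC scalerA.
Qed.

Lemma intv_monov k w : intv (monov k w) = monov k.+1 (k.+1%:R^-1 *: w).
Proof.
apply/matrixP => i j; rewrite !mxE; apply/polyP => -[|l];
  rewrite coef_intp coefZ coefXn ?mulr0 //.
rewrite coefZ coefXn eqSS; case: eqP => [->|_]; last by rewrite !mulr0 mul0r.
by rewrite !mulr1 mulrC.
Qed.

Lemma evalv_monov k w s : evalv (monov k w) s = s ^+ k *: w.
Proof. by apply/matrixP => i j; rewrite !mxE hornerZ hornerXn mulrC. Qed.

Lemma evalvD (P Q : 'cV[{poly R}]_M) s : evalv (P + Q) s = evalv P s + evalv Q s.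
Proof. by apply/matrixP => i j; rewrite !mxE hornerD. Qed.

Definition taylorv D v k := monov k (k`!%:R^-1 *: iter k (mulmx D) v).

Lemma taylorv0 D v : taylorv D v 0 = cstp v.
Proof. by rewrite /taylorv fact0 invr1 scale1r monov0. Qed.

Lemma intv_Dp_taylorv D v k : intv (Dp D *m taylorv D v k) = taylorv D v k.+1.
Proof.
rewrite mul_Dp_monov intv_monov /taylorv -scalemxAr scalerA -invfM -natrM.
by rewrite factS.
Qed.

(** Weight, relative to the Taylor term of degree [m + 1], of the surplus that the tilde stage [m]
    carries on top of the Taylor polynomial of degree [m]. *)
Fixpoint topweight (r : nat) (g : R) m :=
  if m is m'.+1 then gam r m g * topweight r g m' else g^-1.

Lemma intv0 : intv (0 : 'cV[{poly R}]_M) = 0.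
Proof.
by apply/matrixP => i j; rewrite !mxE; apply/polyP => -[|k];
  rewrite coef_intp !coef0 ?mul0r.
Qed.

Lemma intv_Dp_sum_taylorv D v m :
  cstp v + intv (Dp D *m \sum_(k < m) taylorv D v k)
    = \sum_(k < m.+1) taylorv D v k.
Proof.
rewrite big_ord_recl taylorv0; congr (_ + _).
rewrite mulmx_sumr (big_morph _ intvD intv0).
by apply: eq_bigr => k _; rewrite intv_Dp_taylorv.
Qed.

Lemma intvZ (a : R) (P : 'cV[{poly R}]_M) : intv (a%:P *: P) = a%:P *: intv P.
Proof.
apply/matrixP => i j; rewrite !mxE; apply/polyP => -[|k];
  by rewrite coefCM !coef_intp ?mulr0 // coefCM mulrA.
Qed.

(** Each stage is a Picard iteration, which lengthens the Taylor polynomial of exp(sD)v by one term.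
    The two mixing weights sum to 1, so the common Taylor part is kept and only the surplus is
    multiplied by gamma. *)
Lemma stagesE D g r v m :
  stages D g r v m = (\sum_(k < m.+1) taylorv D v k,
    \sum_(k < m.+1) taylorv D v k + (topweight r g m)%:P *: taylorv D v m.+1).
Proof.
elim: m => [|m IHm] /=.
  rewrite big_ord_recl big_ord0 addr0 taylorv0; congr (_, _ + _).
  by rewrite -(taylorv0 D) intvZ intv_Dp_taylorv.
rewrite IHm; congr (_, _); rewrite -(intv_Dp_sum_taylorv D v m.+1) //.
rewrite -addrA; congr (_ + _).
rewrite scalerDr addrAC -scalerDl -polyCD addrC subrKC scale1r.
by rewrite mulmxDr intvD scalerA -polyCM -scalemxAr intvZ intv_Dp_taylorv addrC.
Qed.

End Stages.

(** * Coefficients of p(z) p(-z) *)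

Section TruncExp.
Set Implicit Arguments.
Unset Strict Implicit.
Variable R : realType.

Definition texp (r : nat) : {poly R} := \poly_(k < r.+1) k`!%:R^-1.

Lemma deriv_texp r : (texp r)^`() = texp r - r`!%:R^-1 *: 'X^r.
Proof.
apply/polyP => k; rewrite coef_deriv coefB coefZ coefXn !coef_poly ltnS.
have [->|neq_kr] := eqVneq k r; first by rewrite ltnn leqnn mulr1 subrr mul0rn.
rewrite mulr0 subr0 ltnS [(k <= r)%N]leq_eqVlt (negPf neq_kr) /=.
case: ltnP => _; last by rewrite mul0rn.
rewrite -[LHS]mulr_natr factS natrM invfM mulrAC mulVf ?mul1r //.
by rewrite pnatr_eq0.
Qed.

Lemma coef_compN (p : {poly R}) n : (p \Po - 'X)`_n = (-1) ^+ n * p`_n.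
Proof.
have NXn i : (- 'X) ^+ i = (-1) ^+ i *: 'X^i :> {poly R}.
  by rewrite -scaleN1r exprZn.
rewrite coef_comp_poly; case: (ltnP n (size p)) => [lt_n|le_n].
  rewrite (bigD1 (Ordinal lt_n)) //= NXn coefZ coefXn eqxx mulr1 mulrC.
  rewrite big1 ?addr0 // => i; rewrite -val_eqE /= => neq_in.
  by rewrite NXn coefZ coefXn eq_sym (negPf neq_in) !mulr0.
rewrite big1 ?nth_default ?mulr0 // => i _.
by rewrite NXn coefZ coefXn gtn_eqF ?mulr0 // (leq_trans _ le_n).
Qed.

Lemma comp_XnN n : 'X^n \Po - 'X = (-1) ^+ n *: 'X^n :> {poly R}.
Proof. by rewrite rmorphXn /= comp_polyX -scaleN1r exprZn. Qed.

Definition stabp r (c : R) : {poly R} := texp r + c *: 'X^(r.+1).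

Lemma size_stabp r c : (size (stabp r c) <= r.+2)%N.
Proof.
rewrite (leq_trans (size_polyD _ _)) // geq_max (leq_trans (size_poly _ _)) //.
by rewrite (leq_trans (size_scale_leq _ _)) // size_polyXn.
Qed.

Definition amplif r (c : R) : {poly R} := stabp r c * (stabp r c \Po - 'X).

Lemma size_amplif r c : (size (amplif r c) <= r.+2.*2)%N.
Proof.
rewrite (leq_trans (size_polyMleq _ _)) // size_comp_poly2.
  by rewrite (leq_trans (leq_pred _)) // -addnn leq_add ?size_stabp.
by rewrite size_polyN size_polyX.
Qed.

(* T' = T - z^r/r! for T = texp r makes the derivative of T(z) T(-z) a multiple
   of z^r; the coefficients of T(z) T(-z) follow by integration. *)
Lemma deriv_texpM r : (texp r * (texp r \Po - 'X))^`() =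
  r`!%:R^-1 *: ('X^r * ((-1) ^+ r *: texp r - (texp r \Po - 'X))).
Proof.
rewrite derivM deriv_comp derivN derivX deriv_texp linearB /= comp_polyZ.
rewrite comp_XnN -!mul_polyC.
ring.
Qed.

Lemma coef_texpM r n : (texp r * (texp r \Po - 'X))`_n.+1 =
  if (n < r)%N then 0 else
  r`!%:R^-1 * ((-1) ^+ r - (-1) ^+ (n - r)) * (texp r)`_(n - r) / n.+1%:R.
Proof.
have := congr1 (fun p : {poly R} => p`_n) (deriv_texpM r).
rewrite /= coef_deriv coefZ coefXnM coefB coefZ coef_compN -[LHS]mulr_natr.
set P := ((_ * _ : {poly R})`_n.+1); move=> E.
have nz : n.+1%:R != 0 :> R by rewrite pnatr_eq0.
have -> : P = P * n.+1%:R / n.+1%:R by rewrite mulfK.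
by rewrite E; case: ifP => _; [rewrite mulr0 mul0r | congr (_ / _); ring].
Qed.

Lemma amplifE r c : amplif r c = texp r * (texp r \Po - 'X)
  + c *: ('X^(r.+1) * ((texp r \Po - 'X) + (-1) ^+ r.+1 *: texp r))
  + (c ^+ 2 * (-1) ^+ r.+1) *: 'X^(r.+1.*2).
Proof.
rewrite /amplif /stabp linearD /= comp_polyZ comp_XnN.
rewrite -addnn exprD -!mul_polyC; ring.
Qed.

Lemma coef_amplif0 r c : (amplif r c)`_0 = 1.
Proof.
by rewrite coef0M coef_compN coefD coefZ coefXn coef_poly mulr0 addr0 invr1 !mulr1.
Qed.

Lemma coef_amplif r c n : (amplif r c)`_n.+1 =
  if (n < r)%N then 0 else
  (((-1) ^+ r - (-1) ^+ (n - r)) * (r`!%:R^-1 / n.+1%:R - c)) * (texp r)`_(n - r)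
  + c ^+ 2 * (-1) ^+ r.+1 * (n == r.*2.+1)%:R.
Proof.
rewrite amplifE !coefD coef_texpM !coefZ coefXnM coefXn ltnS doubleS eqSS.
case: ltnP => [lt_nr|le_rn]; first by rewrite ltn_eqF ?mulr0 ?addr0 //; lia.
rewrite subSS coefD coefZ coef_compN exprS; ring.
Qed.

Lemma coef_amplif_small r c n : (n <= r)%N -> (amplif r c)`_n = (n == 0%N)%:R.
Proof. by case: n => [|n] le_nr; rewrite ?coef_amplif0 // coef_amplif le_nr. Qed.

(** As [2l - 1 - r] and [r] have opposite parity, the two signs add up, and the resulting factor 2
    turns [1/(2l)] into [1/l]. The bound [l <= r] stays within the degree of [texp] and below the
    [c ^+ 2] term. *)
Lemma coef_amplif_even r c l : (r < l.*2)%N -> (l <= r)%N ->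
  (amplif r c)`_l.*2 =
    (-1) ^+ r * (r`!%:R^-1 / l%:R - 2 * c) / (l.*2 - r.+1)`!%:R.
Proof.
case: l => [//|l] r_lt le_lr; rewrite doubleS coef_amplif coef_poly.
have -> : (l.*2.+1 < r)%N = false by lia.
have -> : (l.*2.+1 - r < r.+1)%N by lia.
have -> : (l.*2.+1 == r.*2.+1) = false by lia.
rewrite mulr0 addr0.
have -> : (-1) ^+ (l.*2.+1 - r) = - (-1) ^+ r :> R.
  rewrite -signr_odd oddB /= ?odd_double; last by lia.
  by rewrite addTb signrN signr_odd.
rewrite subSS -[l.*2.+2]/(l.+1.*2) -muln2 natrM invfM; field.
by rewrite nat1r !pnatr_eq0 -!lt0n !fact_gt0.
Qed.

Lemma coef_amplif_last r c : (amplif r c)`_r.+1.*2 = c ^+ 2 * (-1) ^+ r.+1.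
Proof.
rewrite doubleS coef_amplif coef_poly eqxx mulr1.
have -> : (r.*2.+1 < r)%N = false by lia.
have -> : (r.*2.+1 - r < r.+1)%N = false by lia.
by rewrite mulr0 add0r.
Qed.

End TruncExp.

(** * Alternating sums and contraction for skew matrices *)

Section Stability.
Set Implicit Arguments.
Unset Strict Implicit.
Variable R : realType.

(** The two bounds need each other: in the induction, the upper bound of the tail gives the lower
    bound of the whole sum, and conversely. The factor [*+ (0 < n)] makes the upper bound 0 for the
    empty sum. *)
Lemma alternating_sum_bounds (a : nat -> R) n :
  (forall i, (i < n)%N -> 0 <= a i) ->
  (forall i, (i.+1 < n)%N -> a i.+1 <= a i) ->
  0 <= \sum_(i < n) (-1) ^+ i * a i <= a 0%N *+ (0 < n)%N.
Proof.
elim: n a => [|n IHn] a a_ge0 a_dec; first by rewrite big_ord0 lexx.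
rewrite big_ord_recl expr0 mul1r mulr1n /=.
under eq_bigr do rewrite exprS mulN1r mulNr.
rewrite sumrN subr_ge0.
have /andP[S_ge0 S_le] := IHn (fun i => a i.+1)
  (fun i => a_ge0 i.+1) (fun i => a_dec i.+1).
rewrite gerBl S_ge0 andbT (le_trans S_le) //.
by case: n a_ge0 a_dec {IHn S_ge0 S_le} => [|n] a_ge0 a_dec;
  [exact: a_ge0 | exact: a_dec].
Qed.

Lemma sum_ord_double (F : nat -> R) n :
  \sum_(i < n.*2) F i = \sum_(i < n) (F i.*2 + F i.*2.+1).
Proof.
elim: n => [|n IHn]; first by rewrite !big_ord0.
by rewrite doubleS !big_ord_recr IHn /= addrA.
Qed.

Definition sqn m (v : 'cV[R]_m) : R := \sum_(i < m) (v i ord0) ^+ 2.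

Lemma sqn_ge0 m (v : 'cV[R]_m) : 0 <= sqn v.
Proof. by apply: sumr_ge0 => i _; rewrite sqr_ge0. Qed.

Lemma sqnE m (v : 'cV[R]_m) : sqn v = (v^T *m v) 0 0.
Proof. by rewrite mxE; apply: eq_bigr => i _; rewrite mxE expr2. Qed.

(** * Quadratic forms of powers of a skew matrix *)

Section Moments.
Variables (m : nat) (B : 'M[R]_m.+1) (v : 'cV[R]_m.+1).
Hypothesis skewB : B^T = - B.

Definition moment (A : 'M[R]_m.+1) : R := (v^T *m A *m v) 0 0.

(** Transposition reverses products, but polynomials in [B] commute. *)
Lemma trmx_horner_skew (p : {poly R}) :
  (horner_mx B p)^T = horner_mx B (p \Po - 'X).
Proof.
elim/poly_ind: p => [|p c IHp]; first by rewrite comp_poly0 rmorph0 trmx0.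
rewrite comp_poly_MXaddC !rmorphD !rmorphM !rmorphN /= !horner_mx_C horner_mx_X.
rewrite linearD /= tr_scalar_mx -mulmxE trmx_mul IHp skewB; congr (_ + _).
by rewrite mulNmx mulmxN; congr (- _); apply: comm_mx_horner.
Qed.

Lemma sqn_horner_mx (p : {poly R}) :
  sqn (horner_mx B p *m v) = moment (horner_mx B (p * (p \Po - 'X))).
Proof.
rewrite sqnE trmx_mul trmx_horner_skew mulmxA /moment mulrC rmorphM /= -mulmxE.
by rewrite !mulmxA.
Qed.

Lemma moment_horner_mx (p : {poly R}) n : (size p <= n)%N ->
  moment (horner_mx B p) = \sum_(i < n) p`_i * moment (B ^+ i).
Proof.
move=> le_pn; have -> : p = \poly_(i < n) p`_i.
  apply/polyP => i; rewrite coef_poly; case: ltnP => // le_ni.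
  by rewrite nth_default // (leq_trans le_pn).
rewrite {1}poly_def linear_sum /moment mulmx_sumr mulmx_suml summxE /=.
apply: eq_bigr => i _; rewrite coef_poly ltn_ord linearZ /= rmorphXn /=.
by rewrite horner_mx_X -scalemxAr -scalemxAl mxE.
Qed.

Lemma moment_even l : moment (B ^+ l.*2) = (-1) ^+ l * sqn (B ^+ l *m v).
Proof.
have := sqn_horner_mx 'X^l.
rewrite comp_XnN -scalerAr -exprD addnn linearZ /= !rmorphXn /= horner_mx_X => ->.
rewrite /moment -scalemxAr -scalemxAl [in RHS]mxE mulrA -exprD.
by rewrite addnn -signr_odd odd_double mul1r.
Qed.

(** An odd power of a skew matrix is skew, and a scalar equals its transpose, so this value is its
    own opposite. *)
Lemma moment_odd l : moment (B ^+ l.*2.+1) = 0.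
Proof.
have BT : (B ^+ l.*2.+1)^T = - B ^+ l.*2.+1.
  have := trmx_horner_skew 'X^(l.*2.+1).
  rewrite comp_XnN linearZ /= rmorphXn /= horner_mx_X => ->.
  by rewrite -signr_odd /= odd_double scaleN1r.
have : moment (B ^+ l.*2.+1) = - moment (B ^+ l.*2.+1).
  rewrite /moment -{1}[v^T *m _ *m v]trmxK mxE 2!trmx_mul trmxK BT.
  by rewrite mulNmx mulmxN mxE mulmxA.
by move/eqP; rewrite -addr_eq0 -mulr2n mulrn_eq0 => /orP[//|/eqP].
Qed.

End Moments.

(* [(-1) ^+ (l - r./2.+1) * defect r c l] is the coefficient of q_l in
   |v|^2 - |p(B)v|^2. The division by [l%:R] and the truncated subtraction are
   only meaningful for [r < l.*2]. *)
Definition defect r (c : R) l : R := (-1) ^+ (r + r./2.+1) *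
  (if (l <= r)%N then (2 * c - r`!%:R^-1 / l%:R) / (l.*2 - r.+1)`!%:R
   else c ^+ 2).

(* [r./2.+1] is the least [l] with [r < l.*2]. *)
Lemma amplif_even_defect r c i : (i <= r - r./2)%N ->
  - ((amplif r c)`_(r./2.+1 + i).*2 * (-1) ^+ (r./2.+1 + i)) =
    (-1) ^+ i * defect r c (r./2.+1 + i).
Proof.
move=> le_i; rewrite /defect; have := odd_double_half r; move=> rE.
have sq k : (-1) ^+ k * (-1) ^+ k = 1 :> R by rewrite -expr2 sqrr_sign.
case: (leqP (r./2.+1 + i) r) => [le_r|lt_r].
  rewrite coef_amplif_even //; last by lia.
  rewrite !exprD; ring.
(* Past [l = r] only the top degree [2(r + 1)] remains. *)
have lE : (r./2.+1 + i = r.+1)%N by lia.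
rewrite lE coef_amplif_last -mulrA sq.
rewrite mulrA -exprD.
have -> : (i + (r + r./2.+1) = r.*2.+1)%N by lia.
by rewrite -signr_odd /= odd_double mulN1r mulr1.
Qed.

(** Reduces stability to two scalar conditions: the defects are nonnegative, and each one times [X]
    is at most its predecessor, which compensates the possible growth [q_(l+1) <= X q_l]. *)
Lemma stabp_contraction r c X m (B : 'M[R]_m.+1) (v : 'cV[R]_m.+1) :
  B^T = - B ->
  (forall w, sqn (B *m w) <= X * sqn w) ->
  (forall l, (r < l.*2)%N -> (l <= r.+1)%N -> 0 <= defect r c l) ->
  (forall l, (r < l.*2)%N -> (l <= r)%N -> defect r c l.+1 * X <= defect r c l) ->
  sqn (horner_mx B (stabp r c) *m v) <= sqn v.
Proof.
move=> skewB leBX d_ge0 d_dec.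
rewrite sqn_horner_mx // -/(amplif r c) (moment_horner_mx B v (size_amplif r c)).
rewrite (sum_ord_double (fun i => (amplif r c)`_i * moment v (B ^+ i))).
under eq_bigr => l _ do rewrite moment_odd // mulr0 addr0 moment_even //.
set q := fun l => sqn (B ^+ l *m v).
have q_ge0 l : 0 <= q l by exact: sqn_ge0.
have q_dec l : q l.+1 <= X * q l.
  by rewrite /q exprS -mulmxE -mulmxA.
have rE := odd_double_half r.
(* Split the sum after [l = r./2]: up to there [2l <= r], so only the constant coefficient survives
   and yields [|v|^2]. *)
have -> : r.+2 = (r./2.+1 + (r - r./2).+1)%N by lia.
rewrite big_split_ord big_ord_recl /= coef_amplif0 !mul1r.
rewrite big1 ?addr0 => [|i _]; last first.
  rewrite coef_amplif_small ?mul0r //=.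
  by have := ltn_ord i; rewrite /bump leq0n; lia.
rewrite /q expr0 mul1mx gerDl -oppr_ge0 -sumrN.
set a := fun i => defect r c (r./2.+1 + i) * q (r./2.+1 + i)%N.
rewrite (eq_bigr (fun i : 'I__ => (-1) ^+ i * a i)) => [|i _]; last first.
  rewrite -/(q _) /a [RHS]mulrA [in LHS]mulrA.
  by rewrite -amplif_even_defect ?mulNr // -ltnS ltn_ord.
have a_ge0 i : (i < (r - r./2).+1)%N -> 0 <= a i.
  by move=> lt_i; rewrite mulr_ge0 // d_ge0 //; lia.
have a_dec i : (i.+1 < (r - r./2).+1)%N -> a i.+1 <= a i.
  move=> lt_i; rewrite /a addnS.
  apply: (@le_trans _ _ (defect r c (r./2.+1 + i).+1 * (X * q (r./2.+1 + i)%N))).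
    by rewrite ler_wpM2l // d_ge0 //; lia.
  by rewrite mulrA ler_wpM2r // d_dec //; lia.
by have /andP[] := alternating_sum_bounds a_ge0 a_dec.
Qed.
End Stability.

(** * Sign and decay of the defects under the CFL condition *)

Section CFL.
Set Implicit Arguments.
Unset Strict Implicit.
Variable R : realType.
Implicit Types (g c X : R) (r l : nat).

Lemma modn4_cases r :
  [\/ (r %% 4)%N = 0%N, (r %% 4)%N = 1%N, (r %% 4)%N = 2%N | (r %% 4)%N = 3%N].
Proof.
have := @ltn_pmod r 4 isT.
by case: (r %% 4)%N => [|[|[|[|]]]] // _;
  [apply: Or41 | apply: Or42 | apply: Or43 | apply: Or44].
Qed.

Lemma topweight_eq0 r g : (0 < r)%N -> (r %% 4 == 0)%N || (r %% 4 == 3)%N ->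
  topweight r g r = 0.
Proof. by case: r => // r _ r03; rewrite /= /gam r03 mul0r. Qed.

(** Telescoping: gamma is the quotient of [(m + 1)/(m + g)] by its value at [m - 1], and that
    expression starts at [1/g]. *)
Lemma topweightE r g m : 0 < g -> ~~ ((r %% 4 == 0)%N || (r %% 4 == 3)%N) ->
  topweight r g m = m.+1%:R / (m%:R + g).
Proof.
move=> g_gt0 r12; elim: m => [|m IHm] /=; first by rewrite add0r mul1r.
rewrite IHm /gam (negPf r12); have mg_gt0 : 0 < m%:R + g by rewrite ltr_wpDl.
have m1g_gt0 : 0 < 1 + m%:R + g by rewrite -addrA addr_gt0.
field; apply/and3P; split.
- exact: lt0r_neq0 m1g_gt0.
- exact: lt0r_neq0 mg_gt0.
- by rewrite nat1r pnatr_eq0.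
Qed.

Definition topcoef r g := topweight r g r / r.+1`!%:R.

Lemma topcoefE r g : 0 < g -> ~~ ((r %% 4 == 0)%N || (r %% 4 == 3)%N) ->
  topcoef r g = (r`!%:R * (r%:R + g))^-1.
Proof.
move=> g_gt0 r12; rewrite /topcoef topweightE // factS natrM.
have rg_gt0 : 0 < r%:R + g by rewrite ltr_wpDl.
field; apply/and3P; split.
- exact: lt0r_neq0 rg_gt0.
- by rewrite pnatr_eq0 -lt0n fact_gt0.
- by rewrite nat1r pnatr_eq0.
Qed.

(** This sign is the origin of the cases modulo 4. If it is negative, the last defect is [- c ^+ 2],
    which forces [c = 0]; if it is positive, [2c] has to outweigh [1/(r! l)]. *)
Lemma sign_defect r : (-1) ^+ (r + r./2.+1) =
  (if (r %% 4 == 0)%N || (r %% 4 == 3)%N then -1 else 1) :> R.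
Proof.
have rE := divn_eq r 4; have hE := odd_double_half r.
rewrite -signr_odd.
case: (modn4_cases r) => r4; rewrite r4 /= in rE *.
- by rewrite (_ : odd _ = true) //; lia.
- by rewrite (_ : odd _ = false) //; lia.
- by rewrite (_ : odd _ = false) //; lia.
- by rewrite (_ : odd _ = true) //; lia.
Qed.

(** Used with [n = 2l - r - 1]: passing from [l] to [l + 1] adds two factors to the factorial in
    [defect]. *)
Lemma le_div_fact (u w X : R) n : u * X <= w * (n.+1%:R * n.+2%:R) ->
  u / n.+2`!%:R * X <= w / n`!%:R.
Proof.
move=> le_uw; have F_gt0 k : 0 < k`!%:R :> R by rewrite ltr0n fact_gt0.
rewrite mulrAC ler_pdivrMr // mulrAC ler_pdivlMr //.
rewrite !factS !natrM; apply: le_trans (_ : w * (n.+1%:R * n.+2%:R) * n`!%:R <= _).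
  by rewrite ler_wpM2r // ltW.
by rewrite le_eqVlt; apply/orP; left; apply/eqP; ring.
Qed.

Lemma cfl_sqr r g : 0 < g < 1 -> cfl r g ^+ 2 =
  if (r %% 4 == 0)%N then 6
  else if (r == 1)%N then (1 - g ^+ 2) / 2
  else if (r %% 4 == 1)%N then 2 * (1 - g) / (3 - g)
  else if (r == 2)%N then 2 * (4 - g ^+ 2) / 3
  else if (r %% 4 == 2)%N then 6 * (2 - g) / (4 - g)
  else 2.
Proof.
move=> /andP[g0 g1]; rewrite /cfl.
do !case: ifP => _; rewrite sqr_sqrtr //; try lra; try nra.
- by rewrite divr_ge0 //; lra.
- by rewrite divr_ge0 //; lra.
Qed.

Lemma natB_double r l : (r < l.*2)%N ->
  (l.*2 - r.+1).+1%:R = 2 * l%:R - r%:R :> R.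
Proof. by move=> r_lt; rewrite -natrM -natrB; [congr _%:R|]; lia. Qed.

Lemma defect_bounds03 r g l : 0 < g < 1 -> (0 < r)%N -> (r < l.*2)%N ->
  (r %% 4 == 0)%N || (r %% 4 == 3)%N ->
  ((l <= r.+1)%N -> 0 <= defect r (topcoef r g) l) /\
  ((l <= r)%N -> defect r (topcoef r g) l.+1 * cfl r g ^+ 2
                   <= defect r (topcoef r g) l).
Proof.
move=> /[dup] g01 /andP[g0 g1] r_gt0 r_lt r4.
have F_ge0 k : 0 <= k`!%:R :> R by [].
have l_gt0 : 0 < l%:R :> R by rewrite ltr0n; lia.
have j2E : (l.+1.*2 - r.+1 = (l.*2 - r.+1).+2)%N by lia.
have topcoef0 : topcoef r g = 0 by rewrite /topcoef topweight_eq0 // mul0r.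
have dE k : defect r (0 : R) k =
    if (k <= r)%N then r`!%:R^-1 / k%:R / (k.*2 - r.+1)`!%:R else 0.
  rewrite /defect sign_defect r4 mulr0 sub0r expr0n /=.
  by case: ifP => _; rewrite ?mulr0 // mulN1r mulNr opprK.
rewrite topcoef0 !dE; split=> [_|le_lr].
  by case: ifP => // _; rewrite !mulr_ge0 ?invr_ge0.
rewrite le_lr; case: ifP => [lt_lr|_]; last by rewrite mul0r !mulr_ge0 ?invr_ge0.
rewrite j2E; apply: le_div_fact; rewrite ler_pM ?sqr_ge0 ?mulr_ge0 ?invr_ge0 //.
  rewrite ler_wpM2l ?invr_ge0 // lef_pV2 ?posrE ?ltr0n ?ler_nat //; lia.
(* The factor [(2l - r)(2l - r + 1)] is least at [2l - r = 2] for even [r] and at [2l - r = 1] for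
   odd [r]; the values 6 and 2 are the squared CFL bounds. *)
rewrite cfl_sqr // -natrM; have rE := divn_eq r 4.
case/orP: r4 => /eqP r4; rewrite r4 /= in rE *; first by rewrite ler_nat; nia.
by rewrite !ifF ?ler_nat //; nia.
Qed.

Lemma defect_bounds12 r g l : 0 < g < 1 -> (0 < r)%N -> (r < l.*2)%N ->
  ~~ ((r %% 4 == 0)%N || (r %% 4 == 3)%N) ->
  ((l <= r.+1)%N -> 0 <= defect r (topcoef r g) l) /\
  ((l <= r)%N -> defect r (topcoef r g) l.+1 * cfl r g ^+ 2
                   <= defect r (topcoef r g) l).
Proof.
move=> /[dup] g01 /andP[g0 g1] r_gt0 r_lt r4.
have r_gt0' : 0 < r%:R :> R by rewrite ltr0n.
have r_ge1 : 1 <= r%:R :> R by rewrite ler1n.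
have F_gt0 k : 0 < k`!%:R :> R by rewrite ltr0n fact_gt0.
have rg_gt0 : 0 < r%:R + g by rewrite addr_gt0.
(* This is [2c - 1/(r! k)] for [c = 1/(r! (r + g))]. It is positive when [r < 2k], since then
   [2k - r >= 1 > g]. *)
pose w k := r`!%:R^-1 / (r%:R + g) * (k%:R^-1 * (2 * k%:R - r%:R - g)).
have dE k : (0 < k)%N -> defect r (topcoef r g) k =
    if (k <= r)%N then w k / (k.*2 - r.+1)`!%:R else topcoef r g ^+ 2.
  move=> k_gt0; have k0 : k%:R != 0 :> R by rewrite pnatr_eq0 -lt0n.
  rewrite /defect sign_defect (negPf r4) mul1r topcoefE //; case: ifP => // _.
  congr (_ / _); rewrite /w; field.
  by rewrite k0 (lt0r_neq0 rg_gt0) (lt0r_neq0 (F_gt0 r)).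
have w_ge0 : 0 <= w l.
  apply: mulr_ge0; first by rewrite mulr_ge0 ?invr_ge0 // ltW.
  rewrite mulr_ge0 ?invr_ge0 // -natB_double // subr_ge0.
  by rewrite (le_trans (ltW g1)) // ler1n.
rewrite !dE //; last by lia.
split=> [_|le_lr]; first by case: ifP => _; rewrite ?sqr_ge0 // divr_ge0 // ltW.
rewrite le_lr; case: ifP => [lt_lr|le_rl].
  have -> : (l.+1.*2 - r.+1 = (l.*2 - r.+1).+2)%N by lia.
  apply: le_div_fact; rewrite /w -!mulrA.
  rewrite ler_wpM2l ?invr_ge0 // ler_wpM2l ?invr_ge0 ?(ltW rg_gt0) //.
  (* With [1/(l + 1) <= 1/l], it suffices that [(e + 2 - g) X <= (e - g) e (e + 1)]. The tightest
     case, [e = 1] for odd [r] and [e = 2] for even [r], is exactly the CFL bound for [r >= 5]. *)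
  set e := (l.*2 - r.+1).+1%:R; have eE : e = 2 * l%:R - r%:R by apply: natB_double.
  have -> : (l.*2 - r.+1).+2%:R = e + 1 by rewrite natr1.
  have -> : 2 * l.+1%:R - r%:R - g = e + 2 - g by rewrite eE -natr1; ring.
  rewrite -eE; have e_ge1 : 1 <= e by rewrite ler1n.
  apply: ler_pM; rewrite ?invr_ge0 //.
  - by rewrite mulr_ge0 ?sqr_ge0 //; lra.
  - by rewrite lef_pV2 ?posrE ?ltr0n ?ler_nat //; lia.
  rewrite cfl_sqr //; have rE := divn_eq r 4.
  case: (modn4_cases r) => r4'; rewrite r4' //= in r4 rE *.
    rewrite ifF; last by lia.
    rewrite [leLHS]mulrA ler_pdivrMr; last by lra.
    have le1 : (e + 2 - g) * (1 - g) <= (e - g) * (3 - g) by nra.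
    have P_ge0 : 0 <= (e - g) * (3 - g) by rewrite mulr_ge0 //; lra.
    have e2 : 2 <= e * (e + 1) by nra.
    have := ler_wpM2l P_ge0 e2; lra.
  rewrite !ifF; try lia.
  have e_ge2 : 2 <= e by rewrite /e ler_nat; lia.
  rewrite [leLHS]mulrA ler_pdivrMr; last by lra.
  have le1 : (e + 2 - g) * (2 - g) <= (e - g) * (4 - g) by nra.
  have P_ge0 : 0 <= (e - g) * (4 - g) by rewrite mulr_ge0 //; lra.
  have e6 : 6 <= e * (e + 1) by nra.
  have := ler_wpM2l P_ge0 e6; lra.
(* The last comparison, with the [c ^+ 2] term, amounts to [X <= r^2 - g^2]. For [r = 1] and [r = 2]
   it is the only one, and the CFL bound gives one half and two thirds of that value. *)
have lE : l = r by lia.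
have -> : w l / (l.*2 - r.+1)`!%:R =
    topcoef r g ^+ 2 * ((r%:R - g) * (r%:R + g)).
  rewrite lE topcoefE // /w; clear -r_gt0 rg_gt0 F_gt0.
  case: r r_gt0 rg_gt0 => // r _ rg_gt0.
  have -> : (r.+1.*2 - r.+2 = r)%N by lia.
  have r0 : r.+1%:R != 0 :> R by rewrite pnatr_eq0.
  rewrite factS natrM; move: r0 rg_gt0 (F_gt0 r) => r0 /lt0r_neq0 rg0 /lt0r_neq0 F0.
  move: (r.+1%:R) (r`!%:R) r0 rg0 F0 => x y x0 xg0 y0.
  by field; rewrite xg0 y0 x0.
apply: ler_wpM2l; first exact: sqr_ge0.
rewrite cfl_sqr //; have rE := divn_eq r 4.
case: (modn4_cases r) => r4'; rewrite r4' //= in r4 rE *.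
  case: eqP => [->|r1]; first by nra.
  have r5 : 5 <= r%:R :> R by rewrite ler_nat; lia.
  by rewrite ler_pdivrMr; [nra | lra].
rewrite ifF; last by lia.
case: eqP => [->|r2]; first by nra.
have r6 : 6 <= r%:R :> R by rewrite ler_nat; lia.
by rewrite ler_pdivrMr; [nra | lra].
Qed.

Lemma defect_bounds r g l : 0 < g < 1 -> (0 < r)%N -> (r < l.*2)%N ->
  ((l <= r.+1)%N -> 0 <= defect r (topcoef r g) l) /\
  ((l <= r)%N -> defect r (topcoef r g) l.+1 * cfl r g ^+ 2
                   <= defect r (topcoef r g) l).
Proof.
move=> g01 r_gt0 r_lt.
by case: (boolP ((r %% 4 == 0)%N || (r %% 4 == 3)%N)) => r4;
  [exact: defect_bounds03 | exact: defect_bounds12].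
Qed.

End CFL.

(** * Operator norm and stability of one step *)

Section OneStep.
Set Implicit Arguments.
Unset Strict Implicit.
Variable R : realType.

Lemma l2normE m (v : 'cV[R]_m) : l2norm v = Num.sqrt (sqn v).
Proof. by []. Qed.

Lemma sqr_l2norm m (v : 'cV[R]_m) : l2norm v ^+ 2 = sqn v.
Proof. by rewrite sqr_sqrtr // sqn_ge0. Qed.

Lemma sqnZ m a (v : 'cV[R]_m) : sqn (a *: v) = a ^+ 2 * sqn v.
Proof. by rewrite /sqn mulr_sumr; apply: eq_bigr => i _; rewrite mxE exprMn. Qed.

Lemma sqn_eq0 m (v : 'cV[R]_m) : sqn v = 0 -> v = 0.
Proof.
move=> v0; apply/matrixP => i j; rewrite ord1 mxE.
have := v0 => /psumr_eq0P; move/(_ (fun k _ => sqr_ge0 _))/(_ i isT)/eqP.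
by rewrite sqrf_eq0 => /eqP.
Qed.

(** Needed for the supremum in [opnorm] to be an upper bound. The witness uses absolute row sums, as
    every entry of [x] is at most 1 in absolute value. *)
Lemma l2norm_mulmx_bounded m (D : 'M[R]_m) :
  has_ubound [set l2norm (D *m x) | x in [set x : 'cV[R]_m | l2norm x <= 1]].
Proof.
exists (Num.sqrt (\sum_i (\sum_j `|D i j|) ^+ 2)) => _ [x /= x1 <-].
rewrite ler_wsqrtr // ler_sum // => i _; rewrite -real_normK ?num_real //.
rewrite ler_sqr ?nnegrE ?sumr_ge0 // mxE (le_trans (ler_norm_sum _ _ _)) //.
apply: ler_sum => j _; rewrite normrM ler_piMr //.
rewrite (le_trans _ x1) // -sqrtr_sqr ler_wsqrtr // (bigD1 j) //= lerDl.
by rewrite sumr_ge0 // => k _; rewrite sqr_ge0.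
Qed.

Lemma opnorm_ge0 m (D : 'M[R]_m) : 0 <= opnorm D.
Proof.
apply: le_trans (ub_le_sup (l2norm_mulmx_bounded D) _); last first.
  by exists 0 => //=; rewrite l2normE /sqn big1 ?sqrtr0 // => i _; rewrite mxE expr0n.
exact: sqrtr_ge0.
Qed.

Lemma sqn_mulmx_le m (D : 'M[R]_m) (v : 'cV[R]_m) :
  sqn (D *m v) <= opnorm D ^+ 2 * sqn v.
Proof.
have [v0|v_neq0] := eqVneq (sqn v) 0.
  by rewrite v0 mulr0 (sqn_eq0 v0) mulmx0 /sqn big1 // => i _; rewrite mxE expr0n.
have v_gt0 : 0 < sqn v by rewrite lt_def v_neq0 sqn_ge0.
have nv_gt0 : 0 < l2norm v by rewrite sqrtr_gt0.
rewrite -ler_pdivrMr // -(sqr_l2norm v) -exprVn mulrC -sqnZ scalemxAr -sqr_l2norm.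
rewrite ler_sqr ?nnegrE ?opnorm_ge0 ?sqrtr_ge0 //.
apply: (ub_le_sup (l2norm_mulmx_bounded D)); exists ((l2norm v)^-1 *: v) => //=.
by rewrite l2normE sqnZ exprVn sqr_l2norm mulVf // sqrtr1.
Qed.

(** The power of [s] in each Taylor term is absorbed into the matrix [s *: D]. *)
Lemma evalv_step m (D : 'M[R]_m.+1) g r (v : 'cV[R]_m.+1) s :
  evalv (step D g r v) s = horner_mx (s *: D) (stabp r (topcoef r g)) *m v.
Proof.
have evalT k : evalv (taylorv D v k) s = k`!%:R^-1 *: ((s *: D) ^+ k *m v).
  rewrite /taylorv evalv_monov exprZn -scalemxAl scalerA mulrC -scalerA.
  congr (_ *: (_ *: _)).
  by elim: k => [|k IHk] /=; rewrite ?expr0 ?mul1mx // IHk exprS -mulmxE mulmxA.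
rewrite /step stagesE /= evalvD [evalv (_ *: _) s](_ : _ =
    topweight r g r *: evalv (taylorv D v r.+1) s); last first.
  by apply/matrixP => i j; rewrite !mxE hornerM hornerC.
rewrite evalT scalerA -/(topcoef r g) /stabp rmorphD /= mulmxDl; congr (_ + _).
  rewrite (big_morph (fun P => evalv P s) (fun P Q => evalvD P Q s) (id1 := 0)).
    rewrite /texp poly_def linear_sum mulmx_suml; apply: eq_bigr => k _.
    by rewrite evalT linearZ /= rmorphXn /= horner_mx_X -scalemxAl.
  by apply/matrixP => i j; rewrite !mxE horner0.
by rewrite linearZ /= rmorphXn /= horner_mx_X -scalemxAl.
Qed.

(** Leaving [s] free covers both full steps and points inside a time interval. *)
Lemma l2norm_step_le m (D : 'M[R]_m) g r (v : 'cV[R]_m) s :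
  D + D^T = 0 -> (0 < r)%N -> 0 < g < 1 -> 0 <= s -> s * opnorm D <= cfl r g ->
  l2norm (evalv (step D g r v) s) <= l2norm v.
Proof.
(* Size 0 is separate because the matrix polynomials above are set in size [m.+1]. *)
case: m D v => [|m] D v skewD r_gt0 g01 s_ge0 cflP.
  by rewrite !l2normE /sqn !big_ord0.
rewrite ler_wsqrtr // evalv_step; apply: (stabp_contraction (X := cfl r g ^+ 2)).
- rewrite linearZ /= -scalerN; congr (_ *: _); apply/eqP.
  by rewrite -addr_eq0 addrC skewD.
- move=> w; rewrite -scalemxAl sqnZ.
  apply: (@le_trans _ _ (s ^+ 2 * (opnorm D ^+ 2 * sqn w))).
    by rewrite ler_wpM2l ?sqr_ge0 // sqn_mulmx_le.
  rewrite mulrA -exprMn ler_wpM2r ?sqn_ge0 // ler_sqr ?nnegrE //.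
    by rewrite mulr_ge0 // opnorm_ge0.
  by rewrite (le_trans _ cflP) // mulr_ge0 // opnorm_ge0.
- by move=> l r_lt; have [] := defect_bounds g01 r_gt0 r_lt.
- by move=> l r_lt; have [] := defect_bounds g01 r_gt0 r_lt.
Qed.

Lemma taumax_ge (t : nat -> R) N n : (n < N)%N -> t n.+1 - t n <= taumax t N.
Proof.
move=> lt_nN.
by apply: (le_bigmax_cond _ (fun n : 'I_N => t n.+1 - t n) (j := Ordinal lt_nN)).
Qed.

End OneStep.

(** * Propagation of the one-step bound along the time grid *)

Theorem theorem3p1 (R : realType) (M : nat) (D : 'M[R]_M) (r : nat) (g : R)
    (Y0 : 'cV[R]_M) (N : nat) (t : nat -> R) :
  D + D^T = 0 ->
  (1 <= r)%N ->
  0 < g < 1 ->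
  t 0%N = 0 ->
  (forall n : nat, (n < N)%N -> t n < t n.+1) ->
  taumax t N * opnorm D <= cfl r g ->
  forall (n : nat) (x : R), (n < N)%N -> t n <= x <= t n.+1 ->
    l2norm (Ytilde D g r t Y0 n x) <= l2norm Y0.
Proof.
move=> skewD r_gt0 g01 _ t_incr cflP.
have stepP n s v : (n < N)%N -> 0 <= s <= t n.+1 - t n ->
    l2norm (evalv (step D g r v) s) <= l2norm v.
  move=> lt_nN /andP[s_ge0 s_le]; apply: l2norm_step_le => //.
  apply: le_trans cflP; rewrite ler_wpM2r ?opnorm_ge0 //.
  exact: le_trans s_le (taumax_ge _ lt_nN).
have nodeP n : (n <= N)%N -> l2norm (node D g r t Y0 n) <= l2norm Y0.
  elim: n => [|n IHn] lt_nN //=.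
  apply: le_trans (IHn (ltnW lt_nN)); apply: (stepP _ _ _ lt_nN).
  by rewrite lexx subr_ge0 ltW ?t_incr.
move=> n x lt_nN /andP[le_tx le_xt].
apply: le_trans (nodeP n (ltnW lt_nN)); apply: (stepP _ _ _ lt_nN).
by rewrite subr_ge0 le_tx lerB.
Qed.
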